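(* Let $\mathcal{A}$ be a finite set of propositional atoms (attributes). For any stratified knowledge base $\Theta$ over $\mathcal{A}$, there exist an integer $m\geq 1$, vectors $\mathbf{a},\tilde{\mathbf{a}}\in\mathbb{R}^m$ and thresholds $\lambda_a\in\mathbb{R}$ (for $a\in\mathcal{A}$) such that for every $b\in\mathcal{A}$ and every set $\{a_1,\dots,a_n\}\subseteq\mathcal{A}$ of $n$ distinct attributes: $$b\in \mathrm{Lab}_{\mathrm{dot}}(\mathrm{Emb}_{\mathrm{had}}(a_1,\dots,a_n)) \iff \Theta\models a_1\wedge\dots\wedge a_n\vartriangleright b .$$
   Context: A stratified knowledge base over $\mathcal{A}$ is a finite ranked list $\Theta=(\alpha_1,\dots,\alpha_k)$ of propositional formulas over the atoms $\mathcal{A}$. For propositional formulas $\alpha,\beta$, one writes $\Theta\models\alpha\vartriangleright\beta$ iff there is some $i\in\{0,\dots,k\}$ such that $\alpha_1\wedge\dots\wedge\alpha_i\wedge\alpha\models\beta$ and $\alpha_1\wedge\dots\wedge\alpha_i\wedge\alpha\not\models\neg\beta$, where on the right-hand side $\models$ is standard propositional entailment (for $i=0$ the premise is just $\alpha$). Each attribute $a\in\mathcal{A}$ is assigned two vectors $\mathbf{a},\tilde{\mathbf{a}}\in\mathbb{R}^m$, which may be different, and a threshold $\lambda_a\in\mathbb{R}$. The embedding function is $\mathrm{Emb}_{\mathrm{had}}(a_1,\dots,a_n)=\mathbf{a}_1\odot\dots\odot\mathbf{a}_n$, where $\odot$ is the Hadamard (component-wise) product (for $n=0$, the empty product is the all-ones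 vector and the empty conjunction is $\top$). The labelling function is $\mathrm{Lab}_{\mathrm{dot}}(\mathbf{e})=\{b\in\mathcal{A}\mid \mathbf{e}\cdot\tilde{\mathbf{b}}\geq\lambda_b\}$ for $\mathbf{e}\in\mathbb{R}^m$. *)

(* Defs.v *)
From mathcomp Require Import all_boot all_order all_algebra.
From mathcomp Require Import reals.

Set Implicit Arguments.
Unset Strict Implicit.
Unset Printing Implicit Defensive.

Import Order.TTheory GRing.Theory Num.Theory.

Local Open Scope ring_scope.

Inductive formula (A : Type) : Type :=
| FAtom of A
| FTop
| FBot
| FNot of formula A
| FAnd of formula A & formula A
| FOr of formula A & formula A
| FImp of formula A & formula A.

Arguments FTop {A}.
Arguments FBot {A}.

Fixpoint eval (A : Type) (v : A -> bool) (f : formula A) : bool :=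
  match f with
  | FAtom a => v a
  | FTop => true
  | FBot => false
  | FNot g => ~~ eval v g
  | FAnd g h => eval v g && eval v h
  | FOr g h => eval v g || eval v h
  | FImp g h => eval v g ==> eval v h
  end.

Definition entails (A : Type) (f g : formula A) : Prop :=
  forall v : A -> bool, eval v f -> eval v g.

Definition conj_atoms (A : Type) (s : seq A) : formula A :=
  foldr (fun a f => FAnd (FAtom a) f) FTop s.

(* The first formula of the list is the highest-ranked one. *)
Definition stratified_kb (A : Type) : Type := seq (formula A).

(* alpha_1 /\ ... /\ alpha_i /\ f, which is f itself when i = 0 *)
Definition premise (A : Type) (Theta : stratified_kb A) (i : nat)
    (f : formula A) : formula A :=
  foldr (@FAnd A) f (take i Theta).

Definition kb_entails (A : Type) (Theta : stratified_kb A)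
    (f g : formula A) : Prop :=
  exists i : nat, [/\ (i <= size Theta)%N,
    entails (premise Theta i f) g &
    ~ entails (premise Theta i f) (FNot g)].

Definition hadamard (R : realType) (m : nat) (u v : 'rV[R]_m) : 'rV[R]_m :=
  \row_j (u 0 j * v 0 j).

Definition dotprod (R : realType) (m : nat) (u v : 'rV[R]_m) : R :=
  \sum_(j < m) u 0 j * v 0 j.

Definition emb_had (R : realType) (A : Type) (m : nat) (vec : A -> 'rV[R]_m)
    (s : seq A) : 'rV[R]_m :=
  \big[@hadamard R m/const_mx 1]_(a <- s) vec a.

Definition lab_dot (R : realType) (A : finType) (m : nat)
    (tvec : A -> 'rV[R]_m) (lambda : A -> R) (e : 'rV[R]_m) : {set A} :=
  [set b | dotprod e (tvec b) >= lambda b].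

(* Main.v *)
(** Index the coordinates by the subsets W of A and let [vec a] be the Walsh
    character [W |-> (-1)^[a \in W]].  The Hadamard product over S is then
    the character [W |-> (-1)^|S :&: W|].  The 2^|A| characters are orthogonal,
    so every real function of S is a scalar product of the embedding of S with
    a fixed vector; this applies in particular to the indicator of
    [Theta |= S |> b]. *)
Require Import Defs.
From mathcomp Require Import all_boot all_order all_algebra.
From mathcomp Require Import boolp reals.

Set Implicit Arguments.
Unset Strict Implicit.
Unset Printing Implicit Defensive.

Import Order.TTheory GRing.Theory Num.Theory.

Local Open Scope ring_scope.

Lemma eval_conj_atoms (A : Type) (v : A -> bool) (s : seq A) :
  eval v (conj_atoms s) = all v s.
Proof. by elim: s => //= a s ->. Qed.

Lemma eval_premise (A : Type) (v : A -> bool) (Theta : stratified_kb A)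
    (i : nat) (f : formula A) :
  eval v (premise Theta i f) = all (eval v) (take i Theta) && eval v f.
Proof. by rewrite /premise; elim: (take i Theta) => //= g r ->; rewrite andbA. Qed.

Lemma kb_entails_congr (A : Type) (Theta : stratified_kb A)
    (f f' g : formula A) :
  (forall v, eval v f = eval v f') ->
  kb_entails Theta f g -> kb_entails Theta f' g.
Proof.
move=> eq_f [i [le_i fg fNg]]; exists i; split=> // [v|f'Ng].
  by rewrite eval_premise -eq_f -eval_premise; apply: fg.
by apply: fNg => v; rewrite eval_premise eq_f -eval_premise; apply: f'Ng.
Qed.

(** A conjunction matters only through its set of atoms, so a list [s] may be exchanged for the
    enumeration of a set. *)
Lemma eq_mem_kb_entails (A : eqType) (Theta : stratified_kb A)
    (s t : seq A) (g : formula A) :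
  s =i t ->
  kb_entails Theta (conj_atoms s) g <-> kb_entails Theta (conj_atoms t) g.
Proof.
move=> eq_st; split; apply: kb_entails_congr => v;
  by rewrite !eval_conj_atoms (eq_all_r eq_st).
Qed.

Lemma emb_hadE (R : realType) (A : Type) (m : nat) (vec : A -> 'rV[R]_m)
    (s : seq A) (j : 'I_m) :
  emb_had vec s 0 j = \prod_(a <- s) vec a 0 j.
Proof.
rewrite /emb_had; elim: s => [|a s IHs]; first by rewrite !big_nil mxE.
by rewrite !big_cons mxE IHs.
Qed.

Definition walsh (R : nzRingType) (A : finType) (S W : {set A}) : R :=
  \prod_(a in S) (-1) ^+ (a \in W).

(** The sum over [W] factors into one two-term sum per atom [a]: a sign for the case [a \in W] plus
    1 for the case [a \notin W]. This factor is 2 where [S] and [T] agree on [a] and 0 where they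
    differ. *)
Lemma walsh_orthogonal (R : comNzRingType) (A : finType) (S T : {set A}) :
  \sum_(W : {set A}) walsh R S W * walsh R T W = (2 ^ #|A|)%:R *+ (S == T).
Proof.
transitivity (\prod_(a : A) ((-1) ^+ ((a \in S) + (a \in T)) + 1 : R)).
  rewrite bigA_distr; apply: eq_bigr => W _.
  rewrite /walsh big_mkcond [X in _ * X]big_mkcond -big_split /=.
  apply: eq_bigr => a _.
  by case: (a \in S); case: (a \in T); case: (a \in W);
    rewrite ?expr0 ?expr1 ?mulr1 ?mul1r.
case: eqVneq => [<-|neq_ST].
  rewrite mulr1n natrX -prodr_const; apply: eq_bigr => a _.
  by case: (a \in S); rewrite ?expr0 ?sqrrN ?expr1n.
have /existsP[a neq_a] : [exists a, (a \in S) != (a \in T)].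
  apply: contraR neq_ST => /existsPn eq_ST.
  by apply/eqP/setP => a; apply/eqP; rewrite -[_ == _]negbK.
rewrite mulr0n (bigD1 a) //=.
by case: (a \in S) (a \in T) neq_a => [] [] //= _; rewrite expr1 addNr mul0r.
Qed.

(** After exchanging the sums, orthogonality keeps only [T = S]. The factor [2 ^ #|A|] stays on the
    right, which avoids division. *)
Lemma walsh_interpolation (R : comNzRingType) (A : finType)
    (F : {set A} -> R) (S : {set A}) :
  \sum_(W : {set A}) walsh R S W * (\sum_(T : {set A}) F T * walsh R T W)
    = F S * (2 ^ #|A|)%:R.
Proof.
under eq_bigr => W _ do
  (rewrite big_distrr /=; under eq_bigr => T _ do rewrite mulrCA).
rewrite exchange_big /=.
under eq_bigr => T _ do rewrite -big_distrr walsh_orthogonal.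
rewrite (bigD1 S) //= eqxx mulr1n big1 ?addr0 // => T neq_TS.
by rewrite eq_sym (negbTE neq_TS) mulr0n mulr0.
Qed.

Theorem proposition5 (R : realType) (A : finType) (Theta : stratified_kb A) :
  exists (m : nat) (vec tvec : A -> 'rV[R]_m) (lambda : A -> R),
    (1 <= m)%N /\
    forall (b : A) (s : seq A), uniq s ->
      (b \in lab_dot tvec lambda (emb_had vec s) <->
       kb_entails Theta (conj_atoms s) (FAtom b)).
Proof.
(* Indicator of the entailment as a function of sets; [enum T] fixes one list of atoms for each
   [T]. *)
pose F b (T : {set A}) : R :=
  `[< kb_entails Theta (conj_atoms (enum T)) (FAtom b) >]%:R.
pose W (j : 'I_#|{: {set A}}|) : {set A} := enum_val j.
(* The second vectors hold the unnormalised Walsh coefficients of [F b]. The scalar product will be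
   [2 ^ #|A|] or 0, and the threshold 1 separates the two. *)
exists #|{: {set A}}|, (fun a => \row_j (-1) ^+ (a \in W j)),
  (fun b => \row_j \sum_T F b T * walsh R T (W j)), (fun=> 1).
split=> [|b s uniq_s]; first by apply/card_gt0P; exists set0.
rewrite inE /dotprod.
under eq_bigr => j _.
  (* As [s] has no repeated atom, the product over the list is one over its set; a repetition would
     square a sign. *)
  rewrite emb_hadE big_uniq //= mxE.
  under eq_bigr => a _ do rewrite mxE.
  rewrite (_ : \prod_(a in s) _ = walsh R [set:: s] (W j)); last first.
    by apply: eq_bigl => a; rewrite inE.
  over.
rewrite -(big_enum_val (fun V => walsh R [set:: s] V *
  \sum_(T : {set A}) F b T * walsh R T V)) /= walsh_interpolation.
rewrite (@eq_mem_kb_entails _ _ s (enum [set:: s])); last first.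
  by move=> a; rewrite mem_enum inE.
rewrite /F; case: asboolP => holds; split=> //.
- by rewrite mul1r ler1n expn_gt0.
- by rewrite mul0r ler10.
Qed.
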